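(* Almost surely, $D^\lambda$ converges in Hausdorff distance towards $\mathcal{C}$ as $\lambda\to+\infty$.
   Context: Let $\mu$ be a probability measure on $\mathbb{R}_+$ with $\int R\,\mathrm{d}\mu(R)=1$, $\int R^2\,\mathrm{d}\mu(R)<+\infty$ and $\mu((R_\star,+\infty))=1$ for some $R_\star>0$. Let $\mathbf{Z}$ be a Poisson point process on $\mathbb{R}_+\times[0,2\pi)\times\mathbb{R}_+$ with intensity measure $\mathrm{d}\rho\,\mathrm{d}\theta\,\mathrm{d}\mu(R)$; everything below is built from this single process, simultaneously for all $\lambda>0$. Line process and Crofton cell: to each $(\rho,\theta,R)\in\mathbf{Z}$ associate the line $D_{\rho,\theta}=\{x\in\mathbb{R}^2:\ x_1\cos\theta+x_2\sin\theta=\rho\}$. The Crofton cell $\mathcal{C}$ is the closed (almost surely bounded) convex polygon containing $0$ which is the closure of the connected component containing $0$ of the complement of the union of these lines. Coupled disc model: let $\psi_\lambda(\rho,R)=R\sqrt{1+2\rho/(\lambda^2R)}$. To each $(\rho,\theta,R)\in\mathbf{Z}$ associate the open disc of radius $R$ whose centre has polar coordinates $(\psi_\lambda(\rho,R),\theta)$, and let $\mathcal{O}_\lambda$ be the union of these discs (it does not contain $0$). Let $D_0^\lambda$ be the connected component of $\mathbb{R}^2\setminus\mathcal{O}_\lambda$ containing $0$, and let $D^\lambda=\lambda^2D_0^\lambda$ if this set is bounded, $D^\lambda=K_0$ (a given fixed compact set) otherwise. *)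

(* Defs.v *)
From HB Require Import structures.
From mathcomp Require Import all_boot all_order all_algebra.
From mathcomp Require Import all_classical all_reals all_analysis.
From mathcomp Require Import measurable_realfun.
Set Implicit Arguments.
Unset Strict Implicit.
Unset Printing Implicit Defensive.
Import Order.TTheory GRing.Theory Num.Theory.
Import numFieldNormedType.Exports.
Local Open Scope classical_set_scope.
Local Open Scope ring_scope.

(* Poisson point process on [E] with (diffuse) intensity [nu], realised as a
   random set of points. In [pp_poisson] the weights are written out because
   the library's [poisson_pmf] takes the value 1 at rate 0. *)
Section poisson_point_process.
Context {R : realType} {d : measure_display} {Omega : measurableType d}.
Context {d' : measure_display} {T : measurableType d'}.
Implicit Types (P : probability Omega R) (E : set T) (Z : Omega -> set T).

Definition npoints Z (B : set T) (w : Omega) : \bar R := counting (Z w `&` B).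

Local Open Scope ereal_scope.

Record poisson_point_process P E (nu : {measure set T -> \bar R}) Z : Prop := {
  pp_support : forall w, Z w `<=` E ;
  pp_measurable : forall B, measurable B -> B `<=` E ->
    measurable_fun setT (npoints Z B) ;
  pp_poisson : forall B, measurable B -> B `<=` E -> nu B < +oo ->
    forall k : nat, P [set w | npoints Z B w = k%:R%:E] =
      (let m := fine (nu B) in expR (- m) * m ^+ k / k`!%:R)%R%:E ;
  pp_infinite : forall B, measurable B -> B `<=` E -> nu B = +oo ->
    P [set w | npoints Z B w = +oo] = 1 ;
  pp_independent : forall (n : nat) (B : 'I_n -> set T),
    (forall i, measurable (B i)) -> (forall i, B i `<=` E) ->
    trivIset setT B ->
    forall A : 'I_n -> set (\bar R), (forall i, measurable (A i)) ->
    P (\bigcap_i (npoints Z (B i) @^-1` A i)) =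
      \prod_(i < n) P (npoints Z (B i) @^-1` A i) }.

End poisson_point_process.

(* The library's norm and distance on [R * R] are those of the sup norm, so
   Euclidean discs and the Euclidean Hausdorff distance are defined here.
   Topology and boundedness are the same for both norms. *)
Section euclidean_plane.
Context {R : realType}.
Implicit Types (x y : R * R) (A B : set (R * R)).

Definition euclid_dist x y : R :=
  Num.sqrt ((x.1 - y.1) ^+ 2 + (x.2 - y.2) ^+ 2).

Definition open_disc x (r : R) : set (R * R) := [set y | euclid_dist x y < r].

Definition euclid_thickening A (e : R) : set (R * R) :=
  [set x | exists2 y, A y & euclid_dist x y <= e].

Definition hausdorff_dist A B : \bar R :=
  ereal_inf [set e%:E | e in [set e : R | [/\ 0 <= e,
    A `<=` euclid_thickening B e & B `<=` euclid_thickening A e]]].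

End euclidean_plane.

(* A marked point is a triple [(rho, theta, r)], i.e. [((rho, theta), r)]. *)
Section models.
Context {R : realType}.
Implicit Types (z : R * R * R) (Z : set (R * R * R)) (lambda : R).

(* [measurableTypeR R] is [R] with its Borel sets, on which the library defines
   [lebesgue_measure]. *)
Definition marked_point :=
  (measurableTypeR R * measurableTypeR R * measurableTypeR R)%type.

Definition marked_space : set marked_point :=
  [set z : R * R * R | [/\ 0 <= z.1.1, 0 <= z.1.2 < 2 * pi & 0 <= z.2]].

Definition intensity (mu : probability (measurableTypeR R) R) :
    {measure set marked_point -> \bar R} :=
  (lebesgue_measure \x lebesgue_measure \x mu)%E.

Definition polar_line (rho theta : R) : set (R * R) :=
  [set x | x.1 * cos theta + x.2 * sin theta = rho].

Definition crofton_cell Z : set (R * R) :=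
  closure (connected_component
    (~` \bigcup_(z in Z) polar_line z.1.1 z.1.2) 0).

Definition psi lambda (rho r : R) : R :=
  r * Num.sqrt (1 + 2 * rho / (lambda ^+ 2 * r)).

Definition model_disc lambda z : set (R * R) :=
  let: (rho, theta, r) := z in
  open_disc (psi lambda rho r * cos theta, psi lambda rho r * sin theta) r.

Definition occupied lambda Z : set (R * R) :=
  \bigcup_(z in Z) model_disc lambda z.

Definition empty_component lambda Z : set (R * R) :=
  connected_component (~` occupied lambda Z) 0.

Definition scaled_component (K0 : set (R * R)) lambda Z : set (R * R) :=
  if `[< bounded_set (empty_component lambda Z) >]
  then [set lambda ^+ 2 *: x | x in empty_component lambda Z]
  else K0.

End models.

(* Main.v *)
Require Import Defs.
From HB Require Import structures.
From mathcomp Require Import all_boot all_order all_algebra finmap ring lra.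
From mathcomp Require Import all_classical all_reals all_analysis.
From mathcomp Require Import measurable_realfun.
Import Order.TTheory GRing.Theory Num.Theory.
Import numFieldNormedType.Exports.
Set Implicit Arguments.
Unset Strict Implicit.
Local Open Scope classical_set_scope.
Local Open Scope ring_scope.

(** Write [u] for the unit vector of angle [theta], and [y = lambda^2 x].
    Expanding [|x - psi u|^2 < r^2] with [psi = r s],
    [s = sqrt (1 + 2 rho / (lambda^2 r))], shows that the disc of the point
    [(rho, theta, r)] covers [x] exactly when
      [rho + |y|^2 / (2 r lambda^2) < s (y . u)].
    As [lambda] grows, [s] tends to 1 and the quadratic term to 0, so the
    rescaled disc tends to the half-plane [rho < y . u] bounded by the line of
    the point: the vacant region approaches the intersection of the opposite
    half-planes, which is the Crofton cell.

    The convergence is deterministic for a configuration in which the distances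
    [rho] and the radii [r] are bounded away from 0, and the angles meet each
    of the four open quadrants. The last condition bounds the cell. The first
    two make the comparison uniform over infinitely many points: the error
    [s - 1] is at most [rho / (lambda^2 r)], hence proportional to [rho], and
    the quadratic term is at most a constant over [lambda^2], hence a small
    multiple of the lower bound on [rho]. So on a fixed ball, for [lambda]
    large, a point with [y . u <= (1 - delta) rho] for all points of the
    configuration is vacant ([not_occupied]), and conversely a vacant point
    satisfies [y . u < (1 + delta) rho] for all of them
    ([not_occupied_height]). Therefore the rescaled component contains
    [(1 - delta)] times the cell, since the segments joining it to the origin
    are vacant. It is also contained in [(1 + delta)] times the cell: being
    connected, it cannot leave a ball whose boundary has no vacant point
    ([empty_component_bound]). This gives a Hausdorff distance of order [delta]
    ([hausdorff_dist_scaled_component]).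

    Almost every configuration has these properties. The radii exceed [Rstar]
    because the marks of radius at most [Rstar] have zero intensity; some strip
    [rho <= 1 / (n + 1)] is empty because its intensity tends to 0, so that its
    void probability tends to 1; and each quadrant of angles has infinite
    intensity, hence contains a point. *)

(** * Connected components in the plane *)

Section connectedness.
Context {R : realType}.
Implicit Types (S A : set (R * R)) (f : R * R -> R).

(** Intermediate value theorem: the image of [S] under [f] is an interval, and
    an interval that contains a value below [a] but not [a] stays below [a]. *)
Lemma connected_lt S f (x0 : R * R) (a : R) : connected S -> continuous f ->
  S x0 -> f x0 < a -> (forall x, S x -> f x <> a) -> forall x, S x -> f x < a.
Proof.
move=> Sc fc Sx0 fx0 fa x Sx; rewrite ltNge; apply/negP => afx.
have /connected_intervalP fSi : connected (f @` S).
  exact/connected_continuous_connected/continuous_subspaceT.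
have [y Sy fy] : (f @` S) a.
  by apply: (fSi (f x0) (f x)); [exists x0|exists x|rewrite (ltW fx0) afx].
exact: (fa y).
Qed.

Lemma segment_connected_component A (p : R * R) :
  (forall t : R, 0 <= t <= 1 -> A (t *: p)) -> connected_component A 0 p.
Proof.
move=> tA; pose f (t : R) : R * R := t *: p.
have f01 : connected (f @` `[0, 1]).
  apply: connected_continuous_connected; first exact: segment_connected.
  apply: continuous_subspaceT => t; exact: scalel_continuous.
apply: (connected_component_max _ _ f01).
- by exists 0; rewrite ?/f ?scale0r //= in_itv/= lexx ler01.
- by move=> _ [t + <-]; rewrite /= in_itv/= => /tA.
- by exists 1; rewrite ?/f ?scale1r //= in_itv/= lexx ler01.
Qed.

End connectedness.

(** * Plane geometry *)

Section geometry.
Context {R : realType}.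
Implicit Types (x y : R * R) (theta : R).

Definition height theta x : R := x.1 * cos theta + x.2 * sin theta.

Lemma heightZ theta (a : R) x : height theta (a *: x) = a * height theta x.
Proof. by rewrite /height /= mulrDr !mulrA. Qed.

Lemma continuous_height theta : continuous (height theta).
Proof.
move=> x; rewrite /height.
by apply: cvgD; apply: cvgMl; [exact: cvg_fst|exact: cvg_snd].
Qed.

Lemma norm_coord_le x (M : R) : `|x| <= M -> `|x.1| <= M /\ `|x.2| <= M.
Proof. by rewrite prod_normE ge_max => /andP[]. Qed.

Lemma height_le theta x (M : R) : `|x| <= M -> height theta x <= 2 * M.
Proof.
move=> /norm_coord_le[x1 x2]; apply: (le_trans (ler_norm _)).
apply: (le_trans (ler_normD _ _)); rewrite mulr_natl mulr2n !normrM.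
by apply: lerD; rewrite -[leRHS]mulr1 ler_pM// ler_norml
  ?cos_geN1 ?sin_geN1 ?cos_le1 ?sin_le1.
Qed.

Lemma sqr_norm_le x (M : R) : `|x| <= M -> x.1 ^+ 2 + x.2 ^+ 2 <= 2 * M ^+ 2.
Proof.
move=> xM; have M0 : 0 <= M := le_trans (normr_ge0 _) xM.
move: xM => /norm_coord_le[x1 x2].
rewrite mulr_natl mulr2n.
rewrite -(real_normK (num_real x.1)) -(real_normK (num_real x.2)).
by apply: lerD; rewrite ler_sqr ?nnegrE.
Qed.

Lemma euclid_distC x y : euclid_dist x y = euclid_dist y x.
Proof. by rewrite /euclid_dist -sqrrN opprB -[X in _ + X]sqrrN opprB. Qed.

Lemma euclid_distZ (a K : R) y : `|y| <= K ->
  euclid_dist y (a *: y) <= 2 * `|1 - a| * K.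
Proof.
move=> yK; have K0 : 0 <= K := le_trans (normr_ge0 _) yK.
rewrite /euclid_dist /= -[leRHS]ger0_norm ?mulr_ge0// -sqrtr_sqr ler_wsqrtr//.
rewrite !exprMn (real_normK (num_real _)).
have -> : (y.1 - a * y.1) ^+ 2 + (y.2 - a * y.2) ^+ 2 =
    (1 - a) ^+ 2 * (y.1 ^+ 2 + y.2 ^+ 2) by ring.
rewrite [leRHS](_ : _ = (1 - a) ^+ 2 * (2 ^+ 2 * K ^+ 2)); last by ring.
rewrite ler_wpM2l ?sqr_ge0//.
by have := sqr_norm_le yK; have := sqr_ge0 K; lra.
Qed.
Lemma hausdorff_dist_ge0 (A B : set (R * R)) : (0 <= hausdorff_dist A B)%E.
Proof. by apply: le_ereal_inf_tmp => _ [e [e0 _ _] <-]; rewrite lee_fin. Qed.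

(** Membership in a disc, in the rescaled coordinates. The identity behind it
    is that [|x - psi u|^2 - r^2] is a positive multiple of the difference of
    the two sides: the term [r^2] cancels because [psi^2 = r^2 + 2 rho r /
    lambda^2], which is what the choice of [psi] is for. *)
Lemma model_discP (lambda rho theta r : R) x : 0 < lambda -> 0 < rho -> 0 < r ->
  model_disc lambda (rho, theta, r) x <->
  rho + ((lambda ^+ 2 * x.1) ^+ 2 + (lambda ^+ 2 * x.2) ^+ 2) /
      (2 * r * lambda ^+ 2) <
    Num.sqrt (1 + 2 * rho / (lambda ^+ 2 * r)) * height theta (lambda ^+ 2 *: x).
Proof.
move=> l0 rho0 r0.
have l20 : 0 < lambda ^+ 2 by rewrite exprn_gt0.
have q0 : 0 <= 2 * rho / (lambda ^+ 2 * r) by rewrite divr_ge0 ?mulr_ge0// ltW.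
rewrite /model_disc /open_disc /= /euclid_dist /psi /= heightZ /height.
set s := Num.sqrt (1 + _).
have s2 : s ^+ 2 = 1 + 2 * rho / (lambda ^+ 2 * r).
  by rewrite sqr_sqrtr// addr_ge0.
have cs := cos2Dsin2 theta.
set D := (_ ^+ 2 + _ ^+ 2).
have DE : D - r ^+ 2 = 2 * r / lambda ^+ 2 *
    (rho + ((lambda ^+ 2 * x.1) ^+ 2 + (lambda ^+ 2 * x.2) ^+ 2) /
        (2 * r * lambda ^+ 2) -
      s * (lambda ^+ 2 * (x.1 * cos theta + x.2 * sin theta))).
  transitivity (r ^+ 2 * s ^+ 2 * (cos theta ^+ 2 + sin theta ^+ 2) -
    2 * r * s * (x.1 * cos theta + x.2 * sin theta) +
    x.1 ^+ 2 + x.2 ^+ 2 - r ^+ 2).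
    by rewrite /D; ring.
  rewrite cs s2; field.
  by rewrite !gt_eqF.
have -> : (Num.sqrt D < r) = (D - r ^+ 2 < 0).
  rewrite subr_lt0 -{1}(ger0_norm (ltW r0)) -sqrtr_sqr ltr_sqrt//.
  by rewrite exprn_gt0.
by rewrite DE pmulr_rlt0 ?subr_lt0// divr_gt0// mulr_gt0.
Qed.


(** * The Crofton cell as an intersection of half-planes *)

Section crofton.
Variable Z : set (R * R * R).
Hypothesis rho_gt0 : forall z, Z z -> 0 < z.1.1.

(** The open polygon is star-shaped with respect to the origin, and it avoids
    the lines. *)
Lemma sub_crofton_cell y :
  (forall z, Z z -> height z.1.2 y < z.1.1) -> crofton_cell Z y.
Proof.
move=> yZ; apply: subset_closure; apply: segment_connected_component => t t01.
move=> [z Zz]; rewrite /polar_line /= -/(height z.1.2 (t *: y)) heightZ => zE.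
have /andP[t0 t1] := t01; have := rho_gt0 Zz; have := yZ z Zz; rewrite -zE.
have [h0|h0 hth _] := leP (height z.1.2 y) 0.
  by move=> _; rewrite ltNge mulr_ge0_le0.
by move: hth; rewrite ltNge ler_piMl// ltW.
Qed.

(** A connected set that contains the origin and avoids a line stays on one
    side of it. *)
Lemma crofton_cell_sub y : crofton_cell Z y ->
  forall z, Z z -> height z.1.2 y <= z.1.1.
Proof.
move=> Cy z Zz; have : closed [set x | height z.1.2 x <= z.1.1].
  apply: (closed_comp (f := height z.1.2) (D := [set a | a <= z.1.1])).
    by move=> *; exact: continuous_height.
  exact: closed_le.
move=> /closure_id cE; suff : [set x | height z.1.2 x <= z.1.1] y by [].
rewrite cE; apply: closure_subset y Cy => x Cx /=; apply: ltW.
apply: (@connected_lt _ _ (height z.1.2) 0 _ _ _ _ _ _ x Cx).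
- exact: component_connected.
- exact: continuous_height.
- apply: connected_component_refl => -[z' Zz'].
  by rewrite /polar_line /= !mul0r addr0 => /eqP; rewrite lt_eqF// rho_gt0.
- by rewrite /height /= !mul0r addr0 rho_gt0.
- move=> x' /connected_component_sub Cx' x'z; apply: Cx'; exists z => //.
Qed.

Hypothesis quadrants : forall a b : bool, exists2 z, Z z &
  0 < (-1) ^+ a * cos z.1.2 /\ 0 < (-1) ^+ b * sin z.1.2.

(** If [u] lies in an open quadrant whose closure contains [y], then [y . u] is
    [|y.1| |u.1| + |y.2| |u.2|], so that [y . u <= rho] bounds both coordinates
    of [y]. *)
Lemma bounded_halfplanes : exists K : R, forall y,
  (forall z, Z z -> height z.1.2 y <= z.1.1) -> `|y| <= K.
Proof.
have H (ab : bool * bool) : exists K : R, forall y,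
    (forall z, Z z -> height z.1.2 y <= z.1.1) -> (y.1 < 0, y.2 < 0) = ab ->
    `|y| <= K.
  case: ab => a b; have [z Zz [c0 s0]] := quadrants a b.
  exists (Num.max (z.1.1 / ((-1) ^+ a * cos z.1.2))
                  (z.1.1 / ((-1) ^+ b * sin z.1.2))).
  move=> y /(_ z Zz) yz [y1 y2].
  have yE : height z.1.2 y = `|y.1| * ((-1) ^+ a * cos z.1.2) +
      `|y.2| * ((-1) ^+ b * sin z.1.2).
    rewrite /height {1}[y.1]realEsign ?num_real// y1.
    by rewrite {1}[y.2]realEsign ?num_real// y2; ring.
  rewrite yE in yz; rewrite prod_normE.
  apply: le_max2; rewrite ler_pdivlMr//; apply: le_trans yz.
    by rewrite lerDl mulr_ge0// ltW.
  by rewrite lerDr mulr_ge0// ltW.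
have [K HK] := choice H.
exists (\sum_ab `|K ab|) => y /HK /(_ erefl)yK; apply: (le_trans yK).
rewrite (bigD1 (y.1 < 0, y.2 < 0))//=; apply: (le_trans (ler_norm _)).
by rewrite lerDl sumr_ge0.
Qed.
End crofton.

(** * Vacant points of the rescaled disc model *)

Section discs.
Variables (Z : set (R * R * R)) (rho0 Rs : R).
Hypotheses (rho0_gt0 : 0 < rho0) (Rs_gt0 : 0 < Rs).
Hypothesis rho_ge : forall z, Z z -> rho0 <= z.1.1.
Hypothesis r_ge : forall z, Z z -> Rs <= z.2.

(** The excess of [s (y . u)] over [y . u] is at most [q / 2 * (y . u)] with
    [q / 2 = rho / (lambda^2 r)]; it is proportional to [rho], so that the
    margin [delta * rho] absorbs it even for points at a large distance. *)
Lemma not_occupied (lambda M delta : R) x : 0 < lambda ->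
  `|lambda ^+ 2 *: x| <= M -> 2 * M <= delta * (Rs * lambda ^+ 2) -> delta <= 1 ->
  (forall z, Z z -> height z.1.2 (lambda ^+ 2 *: x) <= (1 - delta) * z.1.1) ->
  ~ occupied lambda Z x.
Proof.
move=> l0 xM Ml d1 xZ [[[rho theta] r] Zz].
have /= rho_gt0 := lt_le_trans rho0_gt0 (rho_ge Zz).
have /= r_gt0 := lt_le_trans Rs_gt0 (r_ge Zz).
have l20 : 0 < lambda ^+ 2 by rewrite exprn_gt0.
have /= hM := height_le theta xM.
move=> /(model_discP _ _ l0 rho_gt0 r_gt0); apply/negP; rewrite -leNgt.
have /= {xZ} := xZ _ Zz; move: hM; move: (height _ _) => h hM hd.
set q := 2 * rho / (lambda ^+ 2 * r).
have q0 : 0 <= q by rewrite divr_ge0 ?mulr_ge0// ltW.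
apply: (@le_trans _ _ rho); last first.
  by rewrite lerDl divr_ge0 ?addr_ge0 ?sqr_ge0// !mulr_ge0// ltW.
have [h0|h0] := leP h 0.
  by apply: le_trans (ltW rho_gt0); rewrite mulr_ge0_le0 ?sqrtr_ge0.
have sq : Num.sqrt (1 + q) <= 1 + q / 2.
  rewrite -[leRHS]ger0_norm -?sqrtr_sqr; last lra.
  by rewrite ler_wsqrtr//; nra.
apply: (le_trans (ler_wpM2r (ltW h0) sq)).
have : q / 2 * h <= delta * rho.
  have -> : q / 2 * h = rho * (h / (lambda ^+ 2 * r)).
    by rewrite /q; field; rewrite !gt_eqF.
  rewrite mulrC ler_pM2r// ler_pdivrMr ?mulr_gt0//.
  apply: (le_trans hM); apply: (le_trans Ml).
  rewrite [Rs * _]mulrC ler_wpM2l//; last first.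
    by rewrite ler_wpM2l ?(ltW l20)//; exact: (r_ge Zz).
  have : 0 < delta * (Rs * lambda ^+ 2).
    exact: lt_le_trans (lt_le_trans h0 hM) Ml.
  by rewrite pmulr_lgt0 ?mulr_gt0// => /ltW.
lra.
Qed.

(** The excess of [s (y . u)] over [y . u] is at most [q / 2 * (y . u)] with
    [q / 2 = rho / (lambda^2 r)]; it is proportional to [rho], so that the
    margin [delta * rho] absorbs it even for points at a large distance. *)
(** Here only [1 <= s] is used, and the quadratic term is absorbed by
    [delta * rho0 <= delta * rho]. *)
Lemma not_occupied_height (lambda M delta : R) x : 0 < lambda ->
  `|lambda ^+ 2 *: x| <= M -> M ^+ 2 < delta * rho0 * (Rs * lambda ^+ 2) ->
  ~ occupied lambda Z x ->
  forall z, Z z -> height z.1.2 (lambda ^+ 2 *: x) < (1 + delta) * z.1.1.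
Proof.
move=> l0 xM Ml xZ [[rho theta] r] Zz /=.
have /= rho_gt0 := lt_le_trans rho0_gt0 (rho_ge Zz).
have /= r_gt0 := lt_le_trans Rs_gt0 (r_ge Zz).
have l20 : 0 < lambda ^+ 2 by rewrite exprn_gt0.
have d0 : 0 < delta.
  have := le_lt_trans (sqr_ge0 M) Ml.
  by rewrite -mulrA pmulr_lgt0// !mulr_gt0.
have : ~ model_disc lambda (rho, theta, r) x.
  by move=> xz; apply: xZ; exists (rho, theta, r).
move=> /(model_discP _ _ l0 rho_gt0 r_gt0)/negP; rewrite -leNgt.
move: (height _ _) => h.
set q := 2 * rho / (lambda ^+ 2 * r).
have q0 : 0 <= q by rewrite divr_ge0 ?mulr_ge0// ltW.
have [h0|h0] := leP h 0.
  by move=> _; apply: (le_lt_trans h0); rewrite mulr_gt0// addr_gt0.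
have sq : 1 <= Num.sqrt (1 + q) by rewrite -[leLHS]sqrtr1 ler_wsqrtr// lerDl.
move=> /(le_trans (ler_wpM2r (ltW h0) sq)); rewrite mul1r => /le_lt_trans; apply.
rewrite [ltRHS]mulrDl mul1r ltrD2l ltr_pdivrMr ?mulr_gt0//.
apply: (le_lt_trans (sqr_norm_le xM)).
have -> : delta * rho * (2 * r * lambda ^+ 2) =
    2 * (delta * lambda ^+ 2 * (rho * r)) by ring.
rewrite ltr_pM2l//; apply: (lt_le_trans Ml).
have -> : delta * rho0 * (Rs * lambda ^+ 2) =
    delta * lambda ^+ 2 * (rho0 * Rs) by ring.
apply: ler_wpM2l; first by rewrite mulr_ge0// ltW.
by apply: ler_pM;
  [exact: ltW|exact: ltW|exact: (rho_ge Zz)|exact: (r_ge Zz)].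
Qed.

End discs.

End geometry.

(** * Convergence for a configuration bounded away from the origin *)

Section convergence.
Context {R : realType}.
Implicit Types (x y : R * R).

Variables (Z : set (R * R * R)) (rho0 Rs : R).
Hypotheses (rho0_gt0 : 0 < rho0) (Rs_gt0 : 0 < Rs).
Hypothesis rho_ge : forall z, Z z -> rho0 <= z.1.1.
Hypothesis r_ge : forall z, Z z -> Rs <= z.2.

Let rho_gt0 z : Z z -> 0 < z.1.1.
Proof. by move=> /rho_ge; exact: lt_le_trans. Qed.

Section radius.
Variable K : R.
Hypothesis K_gt0 : 0 < K.
Hypothesis K_bound : forall y,
  (forall z, Z z -> height z.1.2 y <= z.1.1) -> `|y| <= K.

Variables lambda delta : R.
Hypotheses (l_gt0 : 0 < lambda) (d_gt0 : 0 < delta) (d_le1 : delta <= 1).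
Hypothesis l_far : 2 * (3 * K) <= delta * (Rs * lambda ^+ 2).
Hypothesis l_far' : (3 * K) ^+ 2 < delta * rho0 * (Rs * lambda ^+ 2).

Let l2_gt0 : 0 < lambda ^+ 2. Proof. by rewrite exprn_gt0. Qed.
Let d1_gt0 : 0 < 1 + delta. Proof. by rewrite addr_gt0. Qed.

Let vacant_shrink x : `|lambda ^+ 2 *: x| <= 3 * K -> ~ occupied lambda Z x ->
  (forall z, Z z -> height z.1.2 ((1 + delta)^-1 *: (lambda ^+ 2 *: x)) < z.1.1).
Proof.
move=> xK xZ z Zz; rewrite heightZ mulrC ltr_pdivrMr// mulrC.
exact: (not_occupied_height rho0_gt0 Rs_gt0 rho_ge r_ge l_gt0 xK l_far' xZ).
Qed.

Let crofton_bound y : crofton_cell Z y -> `|y| <= K.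
Proof. by move=> Cy; exact/K_bound/(crofton_cell_sub rho_gt0 Cy). Qed.

Let origin : empty_component lambda Z 0.
Proof.
apply: connected_component_refl.
apply: (not_occupied rho0_gt0 Rs_gt0 rho_ge r_ge l_gt0 _ l_far d_le1).
  by rewrite scaler0 normr0 mulr_ge0// ltW.
move=> z Zz; rewrite scaler0 /height /= !mul0r addr0 mulr_ge0 ?subr_ge0//.
exact/ltW/rho_gt0.
Qed.

(** Vacant points of the ball of radius [3 K] lie in [(1 + delta)] times the
    cell, hence in the ball of radius [2 K]; none is on the boundary of the
    former, so the component cannot leave it. *)
Lemma empty_component_bound x : empty_component lambda Z x ->
  `|lambda ^+ 2 *: x| < 3 * K.
Proof.
apply: (@connected_lt _ _ (fun x : R * R => `|lambda ^+ 2 *: x|) 0).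
- exact: component_connected.
- move=> y; apply: continuous_comp; first exact: scaler_continuous.
  exact: norm_continuous.
- exact: origin.
- by rewrite scaler0 normr0 mulr_gt0.
move=> {}x /connected_component_sub xZ xK.
have : `|(1 + delta)^-1 *: (lambda ^+ 2 *: x)| <= K.
  apply: K_bound => z Zz; apply/ltW/vacant_shrink => //; by rewrite xK.
rewrite normrZ xK gtr0_norm ?invr_gt0// mulrC ler_pdivrMr//.
have := K_gt0; have := d_le1; nra.
Qed.

(** One inclusion compares a point [c] of the cell with [(1 + delta) c] in the
    component, the other with [(1 - delta) c], at distance at most [2 delta K]. *)
Lemma hausdorff_dist_scaled_component K0 :
  (hausdorff_dist (scaled_component K0 lambda Z) (crofton_cell Z) <=
   (2 * delta * K)%:E)%E.
Proof.
apply: ereal_inf_lbound; exists (2 * delta * K) => //.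
rewrite /scaled_component asboolT; last first.
  exists (3 * K / lambda ^+ 2); split; first exact: num_real.
  move=> M /ltW KM x /empty_component_bound /ltW.
  rewrite normrZ (gtr0_norm l2_gt0) mulrC -ler_pdivlMr// => xK.
  exact: le_trans KM.
split; first by rewrite !mulr_ge0// ltW.
- move=> _ [x Sx <-].
  set c := (1 + delta)^-1 *: (lambda ^+ 2 *: x).
  have xE : lambda ^+ 2 *: x = (1 + delta) *: c.
    by rewrite scalerA divff ?scale1r// gt_eqF.
  have Cc : crofton_cell Z c.
    apply: (sub_crofton_cell rho_gt0) => z Zz; apply: vacant_shrink => //.
      exact/ltW/empty_component_bound.
    exact: connected_component_sub Sx.
  exists c => //; rewrite xE euclid_distC.
  apply: (le_trans (euclid_distZ (1 + delta) (crofton_bound Cc))).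
  by rewrite opprD addNKr normrN gtr0_norm.
- move=> c Cc; exists ((1 - delta) *: c); last first.
    apply: (le_trans (euclid_distZ (1 - delta) (crofton_bound Cc))).
    by rewrite opprB addrC subrK gtr0_norm.
  exists ((lambda ^+ 2)^-1 *: ((1 - delta) *: c)); last first.
    by rewrite scalerA divff ?scale1r// gt_eqF.
  (* the cell is star-shaped, so the whole segment to the origin is vacant *)
  apply: segment_connected_component => t /andP[t0 t1].
  have E : lambda ^+ 2 *: (t *: ((lambda ^+ 2)^-1 *: ((1 - delta) *: c))) =
      (t * (1 - delta)) *: c.
    by rewrite !scalerA; congr (_ *: _); field; rewrite gt_eqF.
  have d0 : 0 <= 1 - delta by rewrite subr_ge0.
  apply: (not_occupied rho0_gt0 Rs_gt0 rho_ge r_ge l_gt0 _ l_far d_le1).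
    rewrite E normrZ ger0_norm ?mulr_ge0//.
    have := crofton_bound Cc; have := normr_ge0 c; have := K_gt0; have := d_gt0.
    move: `|c| => n *; apply: (@le_trans _ _ (1 * K)); last lra.
    apply: ler_pM => //; first exact: mulr_ge0.
    by rewrite mulr_ile1//; lra.
  move=> z Zz; rewrite E heightZ mulrAC mulrC ler_wpM2l//.
  have hz := crofton_cell_sub rho_gt0 Cc Zz.
  have [h0|h0] := leP (height z.1.2 c) 0.
    by apply: (@le_trans _ _ 0); [rewrite mulr_ge0_le0|exact/ltW/rho_gt0].
  by apply: le_trans hz; rewrite ler_piMl// ltW.
Qed.
End radius.

Hypothesis quadrants : forall a b : bool, exists2 z, Z z &
  0 < (-1) ^+ a * cos z.1.2 /\ 0 < (-1) ^+ b * sin z.1.2.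

Lemma scaled_component_cvg K0 :
  hausdorff_dist (scaled_component K0 lambda Z) (crofton_cell Z)
    @[lambda --> +oo] --> 0%E.
Proof.
have [K' HK'] := bounded_halfplanes quadrants.
pose K := Num.max K' 1.
have K_gt0 : 0 < K by rewrite lt_max ltr01 orbT.
have HK y : (forall z, Z z -> height z.1.2 y <= z.1.1) -> `|y| <= K.
  by move=> /HK' yK; rewrite le_max yK.
have near_le (e : R) : 0 < e -> \forall lambda \near +oo,
    (hausdorff_dist (scaled_component K0 lambda Z) (crofton_cell Z) <= e%:E)%E.
  move=> e0; pose delta := Num.min 1 (e / (2 * K)).
  have d_gt0 : 0 < delta by rewrite lt_min ltr01 divr_gt0// mulr_gt0.
  have d_le1 : delta <= 1 by rewrite ge_min lexx.
  have dK : 2 * delta * K <= e.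
    by rewrite mulrAC mulrC -ler_pdivlMr ?mulr_gt0// ge_min lexx orbT.
  near=> lambda.
  have l1 : 1 <= lambda by near: lambda; exact: nbhs_pinfty_ge.
  have l0 : 0 < lambda by apply: lt_le_trans l1.
  have ll : lambda <= lambda ^+ 2 by rewrite expr2 ler_peMl// ltW.
  apply: (@le_trans _ _ (2 * delta * K)%:E); last by rewrite lee_fin.
  apply: hausdorff_dist_scaled_component => //.
    rewrite [leRHS]mulrA [leRHS]mulrC -ler_pdivrMr ?mulr_gt0//; apply: le_trans ll.
    by near: lambda; apply: nbhs_pinfty_ge; exact: num_real.
  rewrite [ltRHS]mulrA [ltRHS]mulrC -ltr_pdivrMr ?mulr_gt0//; apply: lt_le_trans ll.
  by near: lambda; apply: nbhs_pinfty_gt; exact: num_real.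
apply/fine_cvgP; split.
  near=> lambda; rewrite ge0_fin_numE ?hausdorff_dist_ge0//.
  by apply: (@le_lt_trans _ _ 1%:E); [near: lambda; exact: near_le|rewrite ltry].
apply/cvgr0Pnorm_le => e /near_le; apply: filterS => lambda /= he.
rewrite ger0_norm ?fine_ge0 ?hausdorff_dist_ge0// -lee_fin fineK//.
by rewrite ge0_fin_numE ?hausdorff_dist_ge0//; apply: (le_lt_trans he); rewrite ltry.
Unshelve. all: by end_near.
Qed.
End convergence.

(** * Almost sure properties of Poisson processes *)

Lemma ae_of_probability1 {R : realType} d (Omega : measurableType d)
  (P : probability Omega R) (A : set Omega) : measurable A -> P A = 1%E ->
  {ae P, forall w, A w}.
Proof.
move=> mA PA; exists (~` A); split => //; first exact: measurableC.
by rewrite probability_setC// PA subee.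
Qed.

Section poisson.
Context {R : realType} d (Omega : measurableType d) (P : probability Omega R).
Context d' (T : measurableType d') (E : set T) (nu : {measure set T -> \bar R}).
Variable Z : Omega -> set T.
Hypothesis Z_poisson : poisson_point_process P E nu Z.

Lemma npoints_eq0 B w : npoints Z B w = 0%E :> \bar R <-> Z w `&` B = set0.
Proof.
rewrite /npoints /counting; split => [|->]; last first.
  by rewrite asboolT ?fset_set0 //; exact: finite_set0.
case: asboolP => // fZ [] /eqP; rewrite pnatr_eq0 cardfs_eq0 => /eqP.
exact: fset_set_set0.
Qed.

Lemma measurable_npoints_eq B (k : \bar R) : measurable B -> B `<=` E ->
  measurable [set w | npoints Z B w = k].
Proof.
move=> mB BE; rewrite -[X in measurable X]setTI.
exact: (pp_measurable Z_poisson mB BE measurableT (emeasurable_set1 k)).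
Qed.

Lemma void_probability B : measurable B -> B `<=` E -> (nu B < +oo)%E ->
  P [set w | npoints Z B w = 0%E :> \bar R] = (expR (- fine (nu B)))%:E.
Proof.
move=> mB BE nuB; rewrite (pp_poisson Z_poisson mB BE nuB 0) /=.
by rewrite expr0 fact0 mulr1 divr1.
Qed.

Lemma ae_no_point B : measurable B -> B `<=` E -> nu B = 0%E ->
  {ae P, forall w, Z w `&` B = set0}.
Proof.
move=> mB BE nuB.
have : {ae P, forall w, [set w | npoints Z B w = 0%E :> \bar R] w}.
  apply: ae_of_probability1; first exact: measurable_npoints_eq.
  by rewrite void_probability// nuB//= oppr0 expR0.
by apply: filterS => w /npoints_eq0.
Qed.

Lemma ae_some_point B : measurable B -> B `<=` E -> nu B = +oo%E ->
  {ae P, forall w, Z w `&` B !=set0}.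
Proof.
move=> mB BE nuB.
have : {ae P, forall w, [set w | npoints Z B w = +oo%E :> \bar R] w}.
  apply: ae_of_probability1; first exact: measurable_npoints_eq.
  exact: (pp_infinite Z_poisson mB BE nuB).
apply: filterS => w /= Zoo; apply/set0P/eqP => /npoints_eq0.
by rewrite Zoo.
Qed.

(** The void probabilities [expR (- nu (B n))] tend to 1 and bound from below
    the probability that some [B n] is empty. *)
Lemma ae_exists_void (B : nat -> set T) :
  (forall n, measurable (B n)) -> (forall n, B n `<=` E) ->
  nu (B n) @[n --> \oo] --> 0%E ->
  {ae P, forall w, exists n, Z w `&` B n = set0}.
Proof.
move=> mB BE /fine_cvgP[fB B0].
pose V n := [set w | npoints Z (B n) w = 0%E :> \bar R].
have mV n : measurable (V n) by exact: measurable_npoints_eq.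
have mU : measurable (\bigcup_n V n) by exact: bigcup_measurable.
have : {ae P, forall w, (\bigcup_n V n) w}.
  apply: ae_of_probability1 => //; apply/eqP; rewrite eq_le probability_le1//=.
  have : expR (- fine (nu (B n))) @[n --> \oo] --> (1 : R).
    rewrite -expR0 -oppr0; apply: continuous_cvg; first exact: continuous_expR.
    exact: cvgN.
  move=> V1; rewrite -(fineK (fin_num_measure P _ mU)) lee_fin.
  apply: (cvgr_to_le V1); near=> n.
  rewrite -lee_fin fineK ?fin_num_measure// -void_probability//.
    apply: le_measure; rewrite ?inE; [exact: mV|exact: mU|].
    by move=> w Vw; exists n.
  by rewrite -ge0_fin_numE//; near: n.
by apply: filterS => w [n _ /npoints_eq0]; exists n.
Unshelve. all: by end_near.
Qed.
End poisson.

(** * The marked point process *)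

(** Booleans encode the signs of the cosine and of the sine. All four quadrants
    are given as [c] and an opening of [pi / 2], so that a single intensity
    computation covers them. *)
Lemma quadrant_sector (R : realType) (a b : bool) : exists2 c : R,
  0 <= c /\ c + pi / 2 <= 2 * pi & forall theta, c < theta < c + pi / 2 ->
    0 < (-1) ^+ a * cos theta /\ 0 < (-1) ^+ b * sin theta.
Proof.
have pi0 := pi_gt0 R.
have first (theta : R) : 0 < theta < pi / 2 -> 0 < cos theta /\ 0 < sin theta.
  move=> t; split; last exact: sin_gt0_pihalf.
  by apply: cos_gt0_pihalf; lra.
have second (theta : R) : pi / 2 < theta < pi -> cos theta < 0 /\ 0 < sin theta.
  move=> t; have [] := first (theta - pi / 2); first by lra.
  by rewrite cosBpihalf sinBpihalf; split; lra.
have half_turn (theta : R) :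
    cos theta = - cos (theta - pi) /\ sin theta = - sin (theta - pi).
  by rewrite -{1 3}(subrK pi theta) cosDpi sinDpi.
case: a; case: b; rewrite /= ?expr0 ?expr1.
- exists pi; first lra; move=> theta t.
  have [] := first (theta - pi); first by lra.
  by have [-> ->] := half_turn theta; split; lra.
- exists (pi / 2); first lra; move=> theta t.
  by have [] := second theta; [lra|split; lra].
- exists (pi + pi / 2); first lra; move=> theta t.
  have [] := second (theta - pi); first by lra.
  by have [-> ->] := half_turn theta; split; lra.
- exists 0; first lra; move=> theta t.
  by have [] := first theta; [lra|split; lra].
Qed.

Section intensity.
Context {R : realType} (mu : probability (measurableTypeR R) R).

Lemma intensity_box (A B C : set (measurableTypeR R)) :
  measurable A -> measurable B -> measurable C ->
  intensity mu (A `*` B `*` C) =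
  (lebesgue_measure A * lebesgue_measure B * mu C)%E.
Proof.
move=> mA mB mC.
transitivity ((lebesgue_measure \x lebesgue_measure)%E (A `*` B) * mu C)%E.
  exact: (product_measure1E (lebesgue_measure \x lebesgue_measure)%E mu
    (measurableX mA mB) mC).
by rewrite product_measure1E.
Qed.

Lemma box_marked_space (A B C : set R) :
  A `<=` `[0, +oo[ -> B `<=` `[0, 2 * pi[ -> C `<=` `[0, +oo[ ->
  A `*` B `*` C `<=` marked_space.
Proof.
move=> AE BE CE [[rho theta] r] [[/= /AE + /BE +] /CE].
by rewrite /= !in_itv/= !andbT => *; split.
Qed.

Hypothesis mu_pos : mu `[0, +oo[%classic = 1%E.

Let ray : set R := `[0, +oo[.
Let circle : set R := `[0, 2 * pi[.

Lemma intensity_sector (a b : R) : a < b ->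
  intensity mu (ray `*` `]a, b[ `*` ray) = +oo%E.
Proof.
move=> ab; rewrite intensity_box; try exact: measurable_itv.
rewrite /ray ?/circle !lebesgue_measure_itv/= lte_fin ab ltry mu_pos mule1.
by rewrite -EFinB gt0_mulye// lte_fin subr_gt0.
Qed.

Lemma intensity_strip (e : R) : 0 < e ->
  intensity mu (`[0, e] `*` circle `*` ray) = (e * (2 * pi))%:E.
Proof.
move=> e0; have pi0 := pi_gt0 R.
rewrite intensity_box; try exact: measurable_itv.
rewrite /ray ?/circle !lebesgue_measure_itv/= !lte_fin e0 mulr_gt0// mu_pos mule1.
by rewrite !sube0.
Qed.

Lemma intensity_small_radius (r : R) : 0 <= r -> mu `]r, +oo[%classic = 1%E ->
  intensity mu (ray `*` circle `*` `[0, r]) = 0%E.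
Proof.
move=> r0 mur; rewrite intensity_box; try exact: measurable_itv.
suff -> : mu `[0, r]%classic = 0%E by rewrite mule0.
have mC : measurable (~` `]r, +oo[%classic : set (measurableTypeR R)).
  by apply: measurableC; exact: measurable_itv.
apply: (subset_measure0 (mu := mu) (B := ~` `]r, +oo[%classic)).
- exact: measurable_itv.
- exact: mC.
- move=> x /=; rewrite !in_itv/= andbT => /andP[_ xr] /(le_lt_trans xr).
  by rewrite ltxx.
have := probability_setC mu (measurable_itv `]r, +oo[).
by rewrite mur subee.
Qed.

Lemma measurable_box (A B C : set (measurableTypeR R)) :
  measurable A -> measurable B -> measurable C ->
  measurable (A `*` B `*` C : set marked_point).
Proof. by move=> mA mB mC; exact: (measurableX (measurableX mA mB) mC). Qed.

Let sub_ray (a : R) : `[0, a]%classic `<=` (`[0, +oo[%classic : set R).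
Proof. by move=> x /=; rewrite !in_itv/= andbT => /andP[]. Qed.

Context d (Omega : measurableType d) (P : probability Omega R).
Variable Z : Omega -> set (R * R * R).
Hypothesis Z_poisson : poisson_point_process P marked_space (intensity mu) Z.

Lemma ae_radius_ge (r : R) : 0 <= r -> mu `]r, +oo[%classic = 1%E ->
  {ae P, forall w, forall z, Z w z -> r <= z.2}.
Proof.
move=> r0 mur.
have : {ae P, forall w, Z w `&` (ray `*` circle `*` `[0, r]) = set0}.
  apply: (ae_no_point Z_poisson).
  - by apply: measurable_box; exact: measurable_itv.
  - exact: box_marked_space.
  - exact: intensity_small_radius.
apply: filterS => w noZ [[rho theta] r'] Zz /=.
rewrite leNgt; apply/negP => r_lt.
have [/= rho_ge0 t_itv r_ge0] := pp_support Z_poisson Zz.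
suff : set0 ((rho, theta), r') by [].
rewrite -noZ; split => //; split; first split.
- by rewrite /ray /= in_itv/= rho_ge0.
- by rewrite /circle /= in_itv.
- by rewrite /= in_itv/= r_ge0 ltW.
Qed.

Lemma ae_distance_ge :
  {ae P, forall w, exists2 rho0 : R, 0 < rho0 & forall z, Z w z -> rho0 <= z.1.1}.
Proof.
have : {ae P, forall w, exists n,
    Z w `&` (`[0, n.+1%:R^-1] `*` circle `*` ray) = set0}.
  apply: (ae_exists_void Z_poisson) => [n|n|].
  - by apply: measurable_box; exact: measurable_itv.
  - exact: box_marked_space.
  under eq_cvg do rewrite intensity_strip ?invr_gt0//.
  apply: cvg_EFin; first exact: nearW.
  by rewrite -(mul0r (2 * pi)); apply: cvgMl; exact: cvg_harmonic.
apply: filterS => w [n noZ]; exists n.+1%:R^-1 => // -[[rho theta] r] Zz /=.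
rewrite leNgt; apply/negP => rho_lt.
have [/= rho_ge0 t_itv r_ge0] := pp_support Z_poisson Zz.
suff : set0 ((rho, theta), r) by [].
rewrite -noZ; split => //; split; first split.
- by rewrite /= in_itv/= rho_ge0 ltW.
- by rewrite /circle /= in_itv.
- by rewrite /ray /= in_itv/= r_ge0.
Qed.

Lemma ae_quadrants : {ae P, forall w, forall a b : bool, exists2 z, Z w z &
  0 < (-1) ^+ a * cos z.1.2 /\ 0 < (-1) ^+ b * sin z.1.2}.
Proof.
have sector (a b : bool) : {ae P, forall w, exists2 z, Z w z &
    0 < (-1) ^+ a * cos z.1.2 /\ 0 < (-1) ^+ b * sin z.1.2}.
  have [c [c0 c2pi] cP] := quadrant_sector R a b.
  have : {ae P, forall w, Z w `&` (ray `*` `]c, c + pi / 2[ `*` ray) !=set0}.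
    apply: (ae_some_point Z_poisson).
    - by apply: measurable_box; exact: measurable_itv.
    - apply: box_marked_space => // x /=; rewrite !in_itv/= => /andP[cx xc].
      by rewrite (le_trans c0 (ltW cx)) (lt_le_trans xc c2pi).
    - by apply: intensity_sector => //; rewrite ltrDl divr_gt0// pi_gt0.
  apply: filterS => w [z [Zz [[_ zc] _]]]; exists z => //; apply: cP.
  by move: zc; rewrite /= in_itv.
have half (a : bool) : {ae P, forall w, forall b : bool, exists2 z, Z w z &
    0 < (-1) ^+ a * cos z.1.2 /\ 0 < (-1) ^+ b * sin z.1.2}.
  by move: (sector a true) (sector a false); apply: filterS2 => w ? ? [].
by move: (half true) (half false); apply: filterS2 => w ? ? [].
Qed.

End intensity.

Theorem theorem3p1 (R : realType)
  (mu : probability (measurableTypeR R) R)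
  (mu_pos : mu `[0, +oo[%classic = 1%E)
  (mu_mean : (\int[mu]_(r in `[0%R, +oo[%classic) r%:E = 1)%E)
  (mu_moment2 : (\int[mu]_(r in `[0%R, +oo[%classic) (r ^+ 2)%:E < +oo)%E)
  (mu_far : exists2 Rstar : R, 0 < Rstar & mu `]Rstar, +oo[%classic = 1%E)
  (d : measure_display) (Omega : measurableType d) (P : probability Omega R)
  (Z : Omega -> set (R * R * R))
  (Z_poisson : poisson_point_process P marked_space (intensity mu) Z)
  (K0 : set (R * R)) (K0_compact : compact K0) :
  {ae P, forall w,
    hausdorff_dist (scaled_component K0 lambda (Z w)) (crofton_cell (Z w))
      @[lambda --> +oo] --> 0%E}.
Proof.
have [Rs Rs_gt0 muRs] := mu_far.
move: (ae_radius_ge Z_poisson (ltW Rs_gt0) muRs)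
  (ae_distance_ge mu_pos Z_poisson) (ae_quadrants mu_pos Z_poisson).
apply: filterS3 => w r_ge [rho0 rho0_gt0 rho_ge] quadrants.
exact: (scaled_component_cvg rho0_gt0 Rs_gt0 rho_ge r_ge quadrants).
Qed.
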